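(* Let $c>0$ be a constant and $p(n)=\frac{c}{n}$. Then $$\lim_{n\to\infty}\mathrm{P}\bigl(G_{n,p(n)}\in\mathcal{D}^n\bigr)=0.$$
   Context: A digraph $G=(V,E)$ on $n$ vertices has $V=\{1,\dots,n\}$ and $E\subseteq V\times V$ (self-loops $(i,i)$ allowed). Its structured matrix $\bar A\in\{0,*\}^{n\times n}$ has $\bar A_{ij}=*$ if $(i,j)\in E$ and $\bar A_{ij}=0$ otherwise. A realization of $\bar A$ is a real matrix obtained by assigning real numbers to the $*$ entries and keeping the zero entries. $G$ (equivalently $\bar A$) is structurally diagonalizable if for almost all (with respect to Lebesgue measure on $\mathbb{R}^{|E|}$) real assignments to the $*$ entries, the resulting matrix is diagonalizable (over $\mathbb{C}$). $\mathcal{D}^n$ is the set of structurally diagonalizable digraphs with $n$ vertices. In the random digraph model $\mathcal{G}(n,p)$ on $n$ labeled vertices, each of the $n^2$ ordered pairs $(u,v)$ (including self-loops $u=v$) is an edge independently with probability $p$. $G_{n,p(n)}$ denotes a random digraph sampled from $\mathcal{G}(n,p(n))$ (for $n\ge c$). *)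

(* Defs.v *)
From HB Require Import structures.
From mathcomp Require Import all_boot all_order all_algebra.
From mathcomp Require Import complex.
From mathcomp Require Import all_classical all_reals all_analysis.

Set Implicit Arguments.
Unset Strict Implicit.
Unset Printing Implicit Defensive.

Import Order.TTheory GRing.Theory Num.Theory.
Import numFieldNormedType.Exports.

Local Open Scope classical_set_scope.
Local Open Scope ring_scope.

(* [(i, j) \in E] is the edge (i, j); self-loops (i, i) are allowed. *)
Notation digraph n := {set ('I_n * 'I_n)%type}.

Section tuple_lebesgue.
Context {R : realType}.
Local Notation mR := (measurableTypeR R).
Local Open Scope ereal_scope.

Definition tuple_cons m (z : mR * m.-tuple mR) : m.+1.-tuple mR :=
  [tuple of z.1 :: z.2].

(* Lebesgue measure on R^m, as the m-fold product of the Lebesgue measure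
   on R, transported along R * R^m -> R^(m+1). *)
Fixpoint tuple_lebesgue (m : nat) : set (m.-tuple mR) -> \bar R :=
  match m with
  | 0%N => \d_([tuple] : 0.-tuple mR)
  | m'.+1 => pushforward (lebesgue_measure \x @tuple_lebesgue m')
                         (@tuple_cons m')
  end.

Lemma measurable_tuple_cons m : measurable_fun setT (@tuple_cons m).
Proof. by apply: measurable_cons. Qed.

Definition cons_measure m (mu : {sigma_finite_measure set (m.-tuple mR) -> \bar R}) :=
  pushforward (lebesgue_measure \x mu) (@tuple_cons m).

HB.instance Definition _ m mu := Measure.copy (@cons_measure m mu)
  (measure_function_pushforward__canonical__measure_function_Measure
     (lebesgue_measure \x mu) (@measurable_tuple_cons m)).

Definition uncons m (t : m.+1.-tuple mR) : mR * m.-tuple mR :=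
  (tnth t ord0, [tuple of behead t]).

Let measurable_uncons m : measurable_fun setT (@uncons m).
Proof.
by apply/measurable_fun_pair; [exact: measurable_tnth|exact: measurable_behead].
Qed.

Let tuple_consK m : cancel (@tuple_cons m) (@uncons m).
Proof. by move=> [x t]; congr pair; exact: val_inj. Qed.

Let cons_measureE m (mu : {sigma_finite_measure set (m.-tuple mR) -> \bar R})
    (A : set mR) (B : set (m.-tuple mR)) : measurable A -> measurable B ->
  cons_measure mu (@uncons m @^-1` (A `*` B)) = lebesgue_measure A * mu B.
Proof.
move=> mA mB; rewrite /cons_measure /pushforward -comp_preimage.
rewrite (_ : _ \o _ = id) ?preimage_id ?product_measure1E//.
by apply/funext => z /=; exact: tuple_consK.
Qed.

Let cons_measure_sigma_finite m mu : sigma_finite setT (@cons_measure m mu).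
Proof.
have /sigma_finiteP[F [FT ndF Foo]] := sigma_finiteT (@lebesgue_measure R).
have /sigma_finiteP[G [GT ndG Goo]] := sigma_finiteT mu.
exists (fun k => @uncons m @^-1` (F k `*` G k)) => [|k].
  rewrite -preimage_bigcup -[LHS](preimage_setT (@uncons m)); congr (_ @^-1` _).
  rewrite -setXTT FT GT predeqE => -[x y]; split; last first.
    by move=> [n _ []/= ? ?]; split; exists n.
  move=> [/= [n _ Fnx] [k _ Gky]]; exists (maxn n k) => //; split.
  - by move: x Fnx; exact/subsetPset/ndF/leq_maxl.
  - by move: y Gky; exact/subsetPset/ndG/leq_maxr.
have [mF Fk] := Foo k; have [mG Gk] := Goo k.
split.
  rewrite -[X in measurable X]setTI; apply: measurable_uncons => //.
  exact: measurableX.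
by rewrite cons_measureE// lte_mul_pinfty// ge0_fin_numE.
Qed.

HB.instance Definition _ m mu := Measure_isSigmaFinite.Build _ _ _
  (@cons_measure m mu) (@cons_measure_sigma_finite m mu).

Let tuple_lebesgue_sf m :
  {mu : {sigma_finite_measure set (m.-tuple mR) -> \bar R} |
    mu = @tuple_lebesgue m :> (set _ -> \bar R)}.
Proof.
elim: m => [|m [mu muE]] /=; first by exists \d_([tuple] : 0.-tuple mR).
exists (@cons_measure m mu : {sigma_finite_measure set _ -> \bar R}).
by rewrite -muE.
Qed.

Let tuple_lebesgue0 m : @tuple_lebesgue m set0 = 0.
Proof. by have [mu <-] := tuple_lebesgue_sf m. Qed.

Let tuple_lebesgue_ge0 m A : 0 <= @tuple_lebesgue m A.
Proof. by have [mu <-] := tuple_lebesgue_sf m. Qed.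

Let tuple_lebesgue_sigma_additive m : semi_sigma_additive (@tuple_lebesgue m).
Proof.
by have [mu <-] := tuple_lebesgue_sf m; exact: measure_semi_sigma_additive.
Qed.

HB.instance Definition _ m := isMeasure.Build _ _ _ (@tuple_lebesgue m)
  (@tuple_lebesgue0 m) (@tuple_lebesgue_ge0 m)
  (@tuple_lebesgue_sigma_additive m).

Let tuple_lebesgue_sigma_finite m : sigma_finite setT (@tuple_lebesgue m).
Proof. by have [mu <-] := tuple_lebesgue_sf m; exact: sigma_finiteT. Qed.

HB.instance Definition _ m := Measure_isSigmaFinite.Build _ _ _
  (@tuple_lebesgue m) (@tuple_lebesgue_sigma_finite m).

Lemma tuple_lebesgue_box m (A : 'I_m -> set mR) :
  (forall i, measurable (A i)) ->
  @tuple_lebesgue m [set t : m.-tuple mR | forall i, A i (tnth t i)] =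
  \prod_(i < m) lebesgue_measure (A i).
Proof.
elim: m A => [|m IH] A mA.
  by rewrite big_ord0 /= diracE mem_set//= => -[].
rewrite big_ord_recl -(IH (fun i => A (lift ord0 i)))//.
have -> : [set t : m.+1.-tuple mR | forall i, A i (tnth t i)] =
    @uncons m @^-1` (A ord0 `*`
      [set t | forall i, A (lift ord0 i) (tnth t i)]).
  apply/seteqP; split=> [t At|t [/= A0 At] i].
    by split => [|i] /=; [|rewrite -(tnthS (thead t)) -tuple_eta]; exact: At.
  case: (unliftP ord0 i) => [j ->|->//].
  by rewrite [t]tuple_eta tnthS; exact: At.
rewrite -[LHS]/(cons_measure (@tuple_lebesgue m) _) cons_measureE//.
rewrite (_ : mkset _ =
    \bigcap_i (fun t : m.-tuple mR => tnth t i) @^-1` A (lift ord0 i)).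
  apply: fin_bigcap_measurable => // i _.
  by rewrite -[X in measurable X]setTI; exact: measurable_tnth.
by apply/seteqP; split=> [t At i _|t At i]; [exact: At|exact: At].
Qed.

End tuple_lebesgue.

(* The coordinates of [x] are assigned to the entries in E in the order of
   [enum E]. *)
Definition realization (R : realType) (n : nat) (E : digraph n)
    (x : #|E|.-tuple (measurableTypeR R)) : 'M[R]_n :=
  \matrix_(i, j)
    if (i, j) \in E then nth 0 (x : seq R) (index (i, j) (enum E)) else 0.

Definition structurally_diagonalizable (R : realType) (n : nat) :
    set (digraph n) :=
  [set E : digraph n | \forall x \ae (@tuple_lebesgue R #|E|),
     diagonalizable (map_mx (real_complex R) (realization x))].

(* Probability of the event D under G(n, p): each of the n^2 ordered pairs e is
   an edge with probability p, independently. *)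
Definition gnp_prob (R : realType) (n : nat) (p : R) (D : set (digraph n)) :
    R :=
  \sum_(E : digraph n | `[< D E >])
    \prod_(e : 'I_n * 'I_n) bernoulli_pmf p (e \in E).

Arguments structurally_diagonalizable : clear implicits.

Lemma gnp_prob_setT (R : realType) (n : nat) (p : R) :
  gnp_prob p [set: digraph n] = 1.
Proof.
rewrite /gnp_prob (eq_bigl xpredT) => [|E]; last exact/asboolT.
transitivity (\prod_(e : 'I_n * 'I_n) (p + (1 - p))).
  by rewrite bigA_distr; apply: eq_bigr.
by rewrite addrC subrK big1.
Qed.

(* Main.v *)
Require Import Defs.
From mathcomp Require Import all_boot all_order all_algebra complex.
From mathcomp Require Import all_classical all_reals all_analysis.
From mathcomp Require Import ring lra zify.
Import Order.TTheory GRing.Theory Num.Theory.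
Import numFieldNormedType.Exports.
Local Open Scope classical_set_scope.
Local Open Scope ring_scope.

(** With probability tending to 1, a sparse random digraph contains a structural Jordan block
    for the eigenvalue 0. Suppose that column i of the structured matrix is
    empty and that the only star of column j is in row i. Every realization A
    then satisfies A e_j = a e_i and A e_i = 0, where a is the entry (i, j), so
    e_j is killed by A^2 but not by A as soon as a != 0, and A is not
    diagonalizable. Since a != 0 on a set of positive measure, one such pair
    (i, j) excludes structural diagonalizability
    ([structurally_diagonalizable_column]).

    It remains to see that such a pair exists with probability tending to 1.
    The condition concerns columns only, and the columns of G(n, p) are
    independent and identically distributed ([gnp_prob_columns]): a column is
    empty with probability r = (1 - p)^n, and equal to a given singleton with
    probability q = p (1 - p)^(n - 1). Look for i in a set H of columns and for
    j outside H. Given the set S of empty columns in H, the m columns outside H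
    all avoid the singletons {i}, i in S, with probability
    (1 - q |S|)^m <= exp(- q m |S|). Averaging over the binomial variable |S|
    bounds the probability that no pair exists by
    (1 - r (1 - exp(- q m)))^|H| ([iid_no_pair_le]). For p = c / n and H one
    half of the columns, r and q m stay bounded away from 0, so this bound
    decays geometrically. *)

(** * Non-diagonalizable digraphs *)

(** For a diagonalizable matrix the generalized eigenspace of 0 is the kernel:
    this holds coordinatewise for a diagonal matrix. *)
Lemma diagonalizable_mulmx_sqr0 {F : fieldType} {n} {A : 'M[F]_n} {v : 'cV[F]_n} :
  diagonalizable A -> A *m (A *m v) = 0 -> A *m v = 0.
Proof.
move=> [P Pu /similar_diagPex[d /(similarP Pu) PA]] AAv0.
have dP u : P *m (A *m u) = diag_mx d *m (P *m u) by rewrite !mulmxA PA.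
suff: P *m (A *m v) = 0 by move/(congr1 (mulmx (invmx P))); rewrite mulKmx// mulmx0.
have : diag_mx d *m (diag_mx d *m (P *m v)) = 0 by rewrite -!dP AAv0 mulmx0.
rewrite dP !mul_diag_mx => ddPv0; apply/matrixP => i k.
move/matrixP/(_ i k): ddPv0; rewrite !mxE => /eqP.
by rewrite mulf_eq0 => /orP[/eqP ->|/eqP //]; rewrite mul0r.
Qed.

Definition column n (E : digraph n) (j : 'I_n) : {set 'I_n} :=
  [set i | (i, j) \in E]%SET.

Lemma in_column n (E : digraph n) i j : (i \in column n E j) = ((i, j) \in E).
Proof. by rewrite inE. Qed.

(** The cube lies in the region where all the starred entries are nonzero,
    which hence is not negligible. *)
Lemma tuple_lebesgue_unit_cube (R : realType) m :
  @tuple_lebesgue R m [set t | forall i, tnth t i \in `[1, 2]%R] = 1%E.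
Proof.
rewrite (tuple_lebesgue_box (A := fun=> `[1, 2]%classic))//.
apply: big1 => i _; rewrite lebesgue_measure_itv/= lte_fin ltr1n/= EFinN.
by congr EFin; ring.
Qed.

(** A column equal to {i} with column i empty makes {e_i, e_j} span a nilpotent
    Jordan block of every realization in which the entry (i, j) is nonzero. *)
Lemma structurally_diagonalizable_column (R : realType) n (E : digraph n) i j :
  structurally_diagonalizable R n E ->
  column n E i = finset.set0 -> column n E j != [set i]%SET.
Proof.
move=> [N [mN N0 badN]] Ei; apply/eqP => Ej.
have Eki k : (k, i) \in E = false by rewrite -in_column Ei inE.
have Ekj k : (k, j) \in E = (k == i) by rewrite -in_column Ej inE.
(* The exceptional null set would contain a cube of measure 1. *)
suff cubeN : [set t | forall k, tnth t k \in `[1, 2]%R] `<=` N.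
  have : (@tuple_lebesgue R #|E| [set t | forall k, (tnth t k \in `[1, 2]%R)] <= 0)%E.
    rewrite -N0; apply: le_measure => //; rewrite inE //.
    rewrite (_ : mkset _ = \bigcap_k
       (fun t : #|E|.-tuple (measurableTypeR R) => tnth t k) @^-1` `[1, 2]%classic).
      apply: fin_bigcap_measurable => // k _.
      by rewrite -[X in measurable X]setTI; exact: measurable_tnth.
    by apply/seteqP; split=> [t + k _|t + k]; [exact|move=> /(_ k I)].
  by rewrite tuple_lebesgue_unit_cube lee_fin ler10.
move=> x xcube; apply: badN => /= /diagonalizable_mulmx_sqr0.
set A := map_mx _ _ => Adiag.
pose a := nth 0 (x : seq R) (index (i, j) (enum E)).
have Aij : A *m delta_mx j 0 = a%:C%C *: delta_mx i 0 :> 'cV_n.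
  rewrite -colE; apply/colP => k; rewrite !mxE Ekj.
  by have [->|_] := eqVneq k i; rewrite /= ?mulr1 ?mulr0.
have Ai0 : A *m delta_mx i 0 = 0 :> 'cV_n.
  by rewrite -colE; apply/colP => k; rewrite !mxE Eki.
have := Adiag (delta_mx j 0 : 'cV_n).
rewrite Aij -scalemxAr Ai0 scaler0 => /(_ erefl)/colP/(_ i).
rewrite !mxE !eqxx mulr1 => -[] a0.
have ltij : (index (i, j) (enum E) < #|E|)%N.
  by rewrite cardE index_mem mem_enum Ekj.
have := xcube (Ordinal ltij); rewrite (tnth_nth 0)/= -/a a0 in_itv/=.
by rewrite ler10.
Qed.

(** * Patterns in independent identically distributed families *)

(** For f with independent values of law w, split the event of the left-hand
    side according to S = {i in H | f i = a}. For fixed S it is a product event,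
    so its probability factors over the indices; bounding (1 - q |S|)^m, for
    m = |~: H|, by an exponential in |S| makes the sum over S factor too. *)
Lemma iid_no_pair_le (R : realType) (I T : finType) (w : T -> R) (a : T)
    (b : I -> T) (q : R) (H : {set I}) :
  (forall t, 0 <= w t) -> \sum_t w t = 1 ->
  injective b -> (forall i, w (b i) = q) ->
  \sum_(f : {ffun I -> T} |
      [forall i in H, forall j in ~: H, (f i == a) ==> (f j != b i)])
    \prod_j w (f j) <=
  (1 - w a * (1 - expR (- (q * #|~: H|%:R)))) ^+ #|H|.
Proof.
move=> w0 w1 binj wb.
(* [G S] is the indicator, as a product over indices, of the event that
   {i in H | f i = a} is S and that f avoids b(S) outside H. The factor
   [j \notin S] restricts S to subsets of H while letting it range over all
   sets, as needed for the final expansion of a product of sums. *)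
pose G (S : {set I}) j t : R :=
  if j \in H then ((t == a) == (j \in S))%:R
  else (j \notin S)%:R * (t \notin [set b i | i in S]%SET)%:R.
have G0 S j t : 0 <= G S j t.
  by rewrite /G; case: ifP => // _; rewrite ?mulr_ge0// ler0n.
have step1 (f : {ffun I -> T}) :
    [forall i in H, forall j in ~: H, (f i == a) ==> (f j != b i)] ->
    \prod_j w (f j) <= \sum_(S : {set I}) \prod_j (w (f j) * G S j (f j)).
  move=> /forall_inP fP; pose Sf := [set i in H | f i == a]%SET.
  rewrite (bigD1 Sf)//= (_ : \prod_j w (f j) =
     \prod_j (w (f j) * G Sf j (f j))); last first.
    apply: eq_bigr => j _; rewrite /G.
    case: ifPn => [jH|jH] /=; first by rewrite inE jH eqxx mulr1.
    have -> : f j \notin [set b i | i in Sf]%SET.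
      apply/negP => fjS; have [i + fjb] := elimT imsetP fjS; rewrite inE => /andP[iH fia].
      by have /forall_inP/(_ j) := fP i iH; rewrite inE jH fia fjb eqxx => /(_ isT).
    by rewrite inE (negPf jH) !mulr1.
  by rewrite lerDl sumr_ge0// => S _; rewrite prodr_ge0// => j _; rewrite mulr_ge0.
apply: (le_trans (ler_sum _ (fun f => step1 f))).
apply: (@le_trans _ _
    (\sum_(f : {ffun I -> T}) \sum_(S : {set I}) \prod_j (w (f j) * G S j (f j)))).
  rewrite [leRHS](bigID (fun f : {ffun I -> T} =>
    [forall i in H, forall j in ~: H, (f i == a) ==> (f j != b i)]))/= lerDl.
  by rewrite sumr_ge0// => f _; rewrite sumr_ge0// => S _; rewrite prodr_ge0// => j _;
    rewrite mulr_ge0.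
rewrite exchange_big/=.
set e := expR _.
have wa (P : pred T) : \sum_(t | P t) w t = 1 - \sum_(t | ~~ P t) w t.
  by rewrite -w1 [X in X - _](bigID P)/= addrK.
have wbS (S : {set I}) :
    \sum_(t | t \notin [set b i | i in S]%SET) w t = 1 - q * #|S|%:R.
  rewrite wa; under eq_bigl do rewrite negbK.
  rewrite big_imset/=; last by move=> ? ? _ _; exact: binj.
  by rewrite (eq_bigr _ (fun i _ => wb i)) sumr_const mulr_natr.
have sumG S j : \sum_t w t * G S j t =
   if j \in H then (if j \in S then w a else 1 - w a)
   else if j \in S then 0 else 1 - q * #|S|%:R.
  rewrite /G; case: ifPn => jH.
    under eq_bigr do rewrite mulr_natr mulrb.
    rewrite -big_mkcond/=; case: ifPn => jS.
      by under eq_bigl do rewrite eqb_id; rewrite big_pred1_eq.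
    by under eq_bigl do rewrite eqbF_neg; rewrite wa; under eq_bigl do rewrite negbK;
       rewrite big_pred1_eq.
  case: ifPn => jS; first by rewrite big1// => t _; rewrite mul0r mulr0.
  under eq_bigr do rewrite mul1r mulr_natr mulrb.
  by rewrite -big_mkcond/= wbS.
have key (S : {set I}) : \prod_j \sum_t w t * G S j t <=
    \prod_j (if j \in S then (if j \in H then w a * e else 0)
             else (if j \in H then 1 - w a else 1)).
  under eq_bigr do rewrite sumG.
  have [SH|] := boolP (S \subset H); last first.
    by case/subsetPn => j jS jH; rewrite (bigD1 j)//= [leRHS](bigD1 j)//= !jS
      (negPf jH) !mul0r.
  pose u j := if j \in H then (if j \in S then w a else 1 - w a) else 1.
  have u0 j : 0 <= u j.
    rewrite /u; do 2?[case: ifP => _ //].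
    by rewrite subr_ge0 -w1 (bigD1 a)//= lerDl sumr_ge0.
  rewrite (_ : \prod_j _ = \prod_j u j * \prod_(j in ~: H) (1 - q * #|S|%:R)); last first.
    rewrite [X in _ = _ * X]big_mkcond -big_split/=; apply: eq_bigr => j _; rewrite /u inE.
    case: ifPn => [|jH]; rewrite ?mulr1// mul1r.
    by rewrite (negPf (contra (fintype.subsetP SH j) jH)).
  rewrite [leRHS](_ : _ = \prod_j u j * \prod_(j in S) e); last first.
    rewrite [X in _ = _ * X]big_mkcond -big_split/=; apply: eq_bigr => j _; rewrite /u.
    case: ifPn => [jS|jS]; last by rewrite mulr1.
    by rewrite (fintype.subsetP SH j jS).
  apply: ler_wpM2l; first by rewrite prodr_ge0.
  rewrite !prodr_const /e -expRM_natl.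
  rewrite [X in expR X](_ : _ = #|~: H|%:R * (- (q * #|S|%:R))); last by ring.
  rewrite expRM_natl lerXn2r ?nnegrE ?expR_ge0//; first by rewrite -wbS sumr_ge0.
  exact: expR_ge1Dx.
apply: (@le_trans _ _ (\sum_(S : {set I}) \prod_j \sum_t w t * G S j t)).
  by apply: ler_sum => S _; rewrite bigA_distr_bigA.
apply: (le_trans (ler_sum _ (fun S _ => key S))).
rewrite -bigA_distr (bigID [in H])/= [X in _ * X]big1 ?mulr1; last first.
  by move=> j /negPf ->; rewrite add0r.
rewrite -prodr_const le_eqVlt; apply/orP; left; apply/eqP.
by apply: eq_bigr => j ->; ring.
Qed.

(** * Columns of the random digraph *)

Lemma sum_set_bernoulli (R : realType) (I : finType) (p : R) :
  \sum_(C : {set I}) \prod_i bernoulli_pmf p (i \in C) = 1.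
Proof.
transitivity (\prod_(i : I) (p + (1 - p))); last first.
  by rewrite addrC subrK big1.
by rewrite bigA_distr; apply: eq_bigr.
Qed.

(** Independence of the columns: a digraph is the family of its columns, and
    its weight is the product of the weights of the columns. *)
Lemma gnp_prob_columns (R : realType) n (p : R) (D : set (digraph n)) :
  gnp_prob p D =
  \sum_(f : {ffun 'I_n -> {set 'I_n}} |
      `[< D [set e | e.1 \in f e.2]%SET >])
    \prod_j \prod_i bernoulli_pmf p (i \in f j).
Proof.
rewrite /gnp_prob (reindex (fun f : {ffun 'I_n -> {set 'I_n}} =>
   [set e | e.1 \in f e.2]%SET)) /=; last first.
  exists (fun E => [ffun j => column n E j]) => [f _|E _].
    by apply/ffunP => j; rewrite ffunE; apply/setP => i; rewrite !inE.
  by apply/setP => -[i j]; rewrite !inE ffunE inE.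
apply: eq_bigr => f _; rewrite exchange_big/= pair_bigA/=.
by apply: eq_bigr => -[i j] _; rewrite inE.
Qed.

Lemma gnp_prob_no_column_pair_le (R : realType) n (p : R) (D : set (digraph n))
    (H : {set 'I_n}) :
  0 <= p <= 1 ->
  (forall E i j, D E -> column n E i = finset.set0 -> column n E j != [set i]%SET) ->
  gnp_prob p D <=
  (1 - (1 - p) ^+ n *
     (1 - expR (- (p * (1 - p) ^+ n.-1 * #|~: H|%:R)))) ^+ #|H|.
Proof.
move=> /andP[p0 p1] DP; rewrite gnp_prob_columns.
pose w (C : {set 'I_n}) := \prod_i bernoulli_pmf p (i \in C).
have w0 C : 0 <= w C.
  by apply: prodr_ge0 => i _; rewrite /bernoulli_pmf; case: ifP; rewrite ?subr_ge0.
have wset0 : w finset.set0 = (1 - p) ^+ n.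
  rewrite /w (eq_bigr (fun=> 1 - p)) ?prodr_const ?card_ord// => i _.
  by rewrite inE.
have wset1 i : w [set i]%SET = p * (1 - p) ^+ n.-1.
  rewrite /w (bigD1 i)//= inE eqxx; congr (_ * _).
  rewrite (eq_bigr (fun=> 1 - p)) ?prodr_const => [|k /negPf ki].
    by rewrite (cardC1 i) card_ord.
  by rewrite inE ki.
rewrite -wset0; apply: le_trans (@iid_no_pair_le R _ _ w finset.set0
  (fun i => [set i]%SET) _ H w0 (sum_set_bernoulli _ _ p) (@set1_inj _) wset1).
rewrite big_mkcond [leRHS]big_mkcond/=; apply: ler_sum => f _.
case: asboolP => [Df|_]; last by case: ifP => _ //; exact: prodr_ge0.
suff -> : [forall i in H, forall j in ~: H, (f i == finset.set0) ==> (f j != [set i]%SET)] by [].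
have fcol k : column n [set e | e.1 \in f e.2]%SET k = f k.
  by apply/setP => i; rewrite !inE.
apply/forall_inP => i _; apply/forall_inP => j _; apply/implyP => /eqP fi0.
by rewrite -fcol; apply: DP Df _; rewrite fcol.
Qed.

(** * Asymptotics for p = c / n *)

(** This is what keeps (1 - c / n)^n above exp(- 2 c). *)
Lemma expRN2_le (R : realType) (x : R) : 0 <= x <= 2^-1 -> expR (- (2 * x)) <= 1 - x.
Proof.
move=> /andP[x0 x2].
rewrite expRN -[leRHS]invrK lef_pV2 ?posrE ?expR_gt0 ?invr_gt0//; last lra.
apply: le_trans (expR_ge1Dx _).
rewrite -div1r ler_pdivrMr; nra.
Qed.

Theorem theorem4p5 (R : realType) (c : R) (hc : 0 < c) :
  (fun n : nat => gnp_prob (c / n%:R) (structurally_diagonalizable R n))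
    @ \oo --> (0 : R).
Proof.
(* [r0] bounds the probability of an empty column from below, [d] bounds
   exp(- q m) from above: q >= p r0, m >= n / 2 and p n = c. *)
pose r0 := expR (- (2 * c)).
have r00 : 0 < r0 by exact: expR_gt0.
have r01 : r0 < 1 by rewrite /r0 expR_lt1; lra.
pose d := expR (- (c / 2 * r0)).
have d0 : 0 < d by exact: expR_gt0.
have d1 : d < 1 by rewrite /d expR_lt1 oppr_lt0 !mulr_gt0 ?invr_gt0.
pose rho := 1 - r0 * (1 - d).
have rho0 : 0 <= rho by rewrite /rho; nra.
have rho1 : rho < 1 by rewrite /rho; nra.
have half_oo : n./2 @[n --> \oo] --> \oo.
  apply/cvgnyPge => A; exists (A.*2)%N => // n /= An.
  by rewrite -(doubleK A) half_leq.
have rho_half : rho ^+ n./2 @[n --> \oo] --> (0 : R).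
  apply: (cvg_comp _ _ half_oo); apply: cvg_expr.
  by rewrite ger0_norm.
apply: squeeze_cvgr (@cvg_cst _ _ _ _ _) rho_half.
near=> n.
have cn : 2 * c <= n%:R by near: n; exact: nbhs_infty_ger.
have n0 : 0 < n%:R :> R by apply: lt_le_trans cn; lra.
pose p := c / n%:R.
have pn : p * n%:R = c by rewrite /p mulfVK// gt_eqF.
have p0 : 0 < p by rewrite divr_gt0.
have p2 : p <= 2^-1 by rewrite /p ler_pdivrMr//; lra.
have p01 : 0 <= p <= 1 by apply/andP; split; lra.
have rle : r0 <= (1 - p) ^+ n.
  rewrite /r0 -pn (_ : - _ = n%:R * (- (2 * p))); last by ring.
  rewrite expRM_natl lerXn2r ?nnegrE ?expR_ge0//; first lra.
  by apply: expRN2_le; apply/andP; split; lra.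
apply/andP; split.
  rewrite sumr_ge0// => E _; apply: prodr_ge0 => e _.
  by rewrite /bernoulli_pmf; case: ifP => _; rewrite -/p; lra.
pose H := [set i : 'I_n | (i < n./2)%N]%SET.
have cardH : #|H| = n./2.
  have hn : (n./2 <= n)%N.
    by rewrite -[leqRHS]odd_double_half -addnn addnA leq_addl.
  by rewrite -sum1dep_card (big_ord_narrow hn) sum1_card card_ord.
apply: le_trans (gnp_prob_no_column_pair_le _ _ _ _ H p01 _) _.
  by move=> E i j; exact: structurally_diagonalizable_column.
have mle : 2^-1 * n%:R <= #|~: H|%:R :> R.
  have := cardsC H; rewrite card_ord cardH => hn.
  have : (n <= 2 * #|~: H|)%N by clear -hn; lia.
  by rewrite -(ler_nat R) natrM; lra.
have qle : r0 <= (1 - p) ^+ n.-1.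
  apply: le_trans rle _; apply: ler_wiXn2l; [lra|lra|exact: leq_pred].
have dle : expR (- (p * (1 - p) ^+ n.-1 * #|~: H|%:R)) <= d.
  rewrite ler_expR lerN2.
  apply: (@le_trans _ _ (p * r0 * (2^-1 * n%:R))).
    by rewrite -pn; move: 2^-1 n%:R => h m; rewrite le_eqVlt; apply/orP; left; apply/eqP; ring.
  apply: ler_pM => //; first by rewrite mulr_ge0// ltW.
  by rewrite ler_pM2l.
have Xle : (1 - p) ^+ n <= 1 by rewrite exprn_ile1//; lra.
rewrite cardH /rho -/p.
move: dle rle Xle; move: (expR _) (expR_ge0 (- (p * (1 - p) ^+ n.-1 * #|~: H|%:R))) => Y.
move: ((1 - p) ^+ n) => X Y0 Yd rX X1.
by apply: lerXn2r; rewrite ?nnegrE; nra.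
Unshelve. all: by end_near.
Qed.
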